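(* Let $q$ be a prime power, let $m \ge n \ge 2$ be integers, fix an integer $d$ with $2 \le d \le n$, and let $k=m(n-d+1)$. Let $\mathcal{F}'$ be the family of $k$-dimensional non-MRD codes in $\mathbb{F}_q^{n\times m}$, that is, the set of $\mathbb{F}_q$-linear subspaces $\mathcal{C} \le \mathbb{F}_q^{n\times m}$ with $\dim(\mathcal{C})=k$ and minimum rank distance at most $d-1$. Then $$|\mathcal{F}'| \ge q\cdot \Lambda(q;mn,m(d-1),k)\cdot\left(1-\frac{(q^k-1)(q^{mn-k}-1)}{2\,(q^{mn}-q^{mn-k})}\right).$$
   Context: The minimum rank distance of a non-zero linear code $\mathcal{C} \le \mathbb{F}_q^{n\times m}$ is the minimum rank of a non-zero matrix in $\mathcal{C}$. A linear code in $\mathbb{F}_q^{n \times m}$ (with $m\ge n$) of minimum rank distance $d$ is MRD if its dimension is $m(n-d+1)$, which is the maximum possible. For non-negative integers $N,t,k$ and a prime power $Q$, $$\Lambda(Q;N,t,k):=\sum_{h=1}^t \left[\begin{matrix} t \\ h \end{matrix}\right]_Q \sum_{s=h}^t \left[\begin{matrix} t-h \\ s-h \end{matrix}\right]_Q\left[\begin{matrix} N-s \\ N-k \end{matrix}\right]_Q(-1)^{s-h}Q^{\binom{s-h}{2}},$$ where $\left[\begin{matrix} a \\ b \end{matrix}\right]_Q$ is the $Q$-binomial coefficient (number of $b$-dimensional subspaces of $\mathbb{F}_Q^a$; zero if $b<0$ or $b>a$). *)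

(* Defs.v *)
From HB Require Import structures.
From mathcomp Require Import all_boot all_order all_algebra.

Set Implicit Arguments.
Unset Strict Implicit.
Unset Printing Implicit Defensive.

Import Order.TTheory GRing.Theory Num.Theory.
Local Open Scope ring_scope.

(* Over a finite field there are finitely many subspaces, so sets of codes can
   be formed and counted with finset. *)
Section FiniteVspace.
Import VectorInternalTheory.
Variables (F : finFieldType) (vT : vectType F).
HB.instance Definition _ := [Countable of {vspace vT} by <:].
HB.instance Definition _ := [Finite of {vspace vT} by <:].
End FiniteVspace.

(* Ranks of n x m matrices are at most n, so for a non-zero code the index n of
   the iterated minimum does not affect the value; for the zero code, whose
   minimum distance is undefined, the value n is a junk value. *)
Definition min_rank_distance (F : finFieldType) (n m : nat)
    (C : {vspace 'M[F]_(n, m)}) : nat :=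
  \big[Order.min/n]_(A in C | A != 0) \rank A.

(* The Q-binomial coefficient [a, b]_Q for Q = #|F|.  The arguments are integers
   since differences such as N - s and N - k may be negative in general;
   for b > a >= 0 there is no subspace to count and the value is 0. *)
Definition qbinom (F : finFieldType) (a b : int) : nat :=
  match a, b with
  | Posz a', Posz b' => #|[set U : {vspace 'rV[F]_a'} | \dim U == b']|
  | _, _ => 0
  end.

(* Lambda(Q; N, t, k) for Q = #|F| *)
Definition Lambda (F : finFieldType) (N t k : nat) : int :=
  \sum_(1 <= h < t.+1) (qbinom F t h)%:Z *
    \sum_(h <= s < t.+1)
      (qbinom F (t%:Z - h%:Z) (s%:Z - h%:Z))%:Z *
      (qbinom F (N%:Z - s%:Z) (N%:Z - k%:Z))%:Z *
      (-1) ^+ (s - h) * (#|F| ^ 'C(s - h, 2))%:Z.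

(* By the Singleton-like bound, for k = m (n - d + 1) and m >= n these are the
   k-dimensional codes of n x m matrices that are not MRD. *)
Definition nonMRD_codes (F : finFieldType) (n m d k : nat) :
    {set {vspace 'M[F]_(n, m)}} :=
  [set C | (\dim C == k) && (min_rank_distance C <= d - 1)%N].

(* Main.v *)
(* With N = mn and t = m(d-1) = N - k, [Lambda] counts the k-spaces meeting a
   fixed t-space, so it equals [N, k]_q - q^(kt), and the last factor of the
   bound is (1 + q^-t)/2.  It remains to bound the number of MRD codes.  Such a
   code meets trivially the space of matrices supported on the last d-1 rows,
   so it is the graph of a linear map from the top n-d+1 rows to these rows.
   Feed this map a matrix whose only non-zero row is its first one, and read
   off one row of the result: this is an m x m block without eigenvectors over
   F_q, as an eigenvector would yield a codeword of rank at most d-1.  By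
   Cauchy-Schwarz, a proportion at most (q-1)/(2q-1) of the m x m matrices has
   no eigenvector, hence there are at most q^(kt) (q-1)/(2q-1) MRD codes.
   Together with [N, k]_q <= q^(kt) / prod_(i <= t) (1 - q^-i), this suffices. *)

Require Import Defs.
From mathcomp Require Import all_boot all_order all_algebra.
From mathcomp Require Import zify ring lra.

Set Implicit Arguments.
Unset Strict Implicit.
Unset Printing Implicit Defensive.

Import Order.TTheory GRing.Theory Num.Theory.
Local Open Scope ring_scope.

(** * Counting subspaces *)

Section RowFreeCount.
Variable F : finFieldType.

Lemma row_free_col_mx_row m n (v : 'rV[F]_n) (A : 'M[F]_(m, n)) :
  row_free (col_mx v A) = row_free A && ~~ (v <= A)%MS.
Proof.
have -> : row_free (col_mx v A) = (\rank (v + A)%MS == m.+1).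
  by rewrite /row_free -addsmxE.
case vA: (v <= A)%MS.
  rewrite andbF; apply/negbTE; rewrite neq_ltn ltnS.
  by rewrite (leq_trans (mxrankS (_ : v + A <= A)%MS)) ?rank_leq_row // addsmx_sub vA /=.
rewrite andbT /row_free.
have v0 : (v :&: A)%MS = 0.
  apply/eqP/rowV0Pn => -[w]; rewrite sub_capmx => /andP[wv wA] w0.
  case/sub_rVP: wv wA w0 => a ->; case: (eqVneq a 0) => [->|a0].
    by rewrite scale0r eqxx.
  by rewrite (eqmx_scale _ a0) vA.
have vn0 : \rank v = 1.
  rewrite rank_rV; case: eqP vA => // ->; by rewrite sub0mx.
by have := mxrank_sum_cap v A; rewrite v0 mxrank0 addn0 vn0 add1n => ->; rewrite eqSS.
Qed.

Lemma card_sub_row_free m n (A : 'M[F]_(m, n)) : row_free A ->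
  #|[set v : 'rV[F]_n | (v <= A)%MS]| = (#|F| ^ m)%N.
Proof.
move=> fA; have -> : [set v : 'rV[F]_n | (v <= A)%MS] = [set u *m A | u in 'rV_m].
  apply/setP => v; rewrite inE; apply/submxP/imsetP => [[u ->]|[u _ ->]]; by exists u.
by rewrite card_imset ?card_mx ?mul1n //; apply: row_free_inj.
Qed.

(** Rows are chosen one at a time, each outside the span of those already chosen. The subtractions
    are truncated, and for m > n the factor i = n is zero, as it should be. *)
Lemma card_row_free m n :
  #|[set A : 'M[F]_(m, n) | row_free A]| = (\prod_(i < m) (#|F| ^ n - #|F| ^ i))%N.
Proof.
elim: m => [|m IHm].
  rewrite big_ord0 -[RHS](_ : #|[set: 'M[F]_(0, n)]| = 1%N); last first.
    by rewrite cardsT card_mx mul0n.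
  by apply: eq_card => A; rewrite !inE /row_free flatmx0 mxrank0.
rewrite big_ord_recr /= -IHm -[LHS]sum1_card.
pose h (p : 'M[F]_(m, n) * 'rV[F]_n) : 'M[F]_(m.+1, n) := col_mx p.2 p.1.
rewrite (reindex h) /=; last first.
  exists (fun B : 'M[F]_(1 + m, n) => (dsubmx B, usubmx B)) => [[A v]|B] _.
    by rewrite /h /= col_mxKd col_mxKu.
  by rewrite /h /= (@vsubmxK _ 1).
rewrite (eq_bigl (fun p => (p.1 \in [set A | row_free A]) && ~~ (p.2 <= p.1)%MS)); last first.
  by move=> [A v]; rewrite !inE /h /= row_free_col_mx_row.
rewrite -(pair_big_dep _ (fun A v => ~~ (v <= A)%MS) (fun _ _ => 1%N)) /=.
rewrite -sum_nat_const; apply: eq_bigr => A fA0.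
have fA : row_free A by move: fA0; rewrite -[X in X -> _]/(is_true (A \in [set A | row_free A])) inE.
rewrite sum1_card -[LHS](_ : #|~: [set v : 'rV[F]_n | (v <= A)%MS]| = _).
  by rewrite cardsCs setCK card_sub_row_free // card_mx mul1n.
by apply: eq_card => v; rewrite !inE.
Qed.

Import VectorInternalTheory.

(** Double counting of ordered bases: each row free matrix spans one k-space, and once a basis [A]
    of a k-space is fixed, its other ordered bases are the [G *m A] with [G] invertible. The product
    form avoids a division in [nat]. *)
Lemma card_vspace_dim (vT : vectType F) k :
  (#|[set U : {vspace vT} | \dim U == k]| *
     \prod_(i < k) (#|F| ^ k - #|F| ^ i) =
   \prod_(i < k) (#|F| ^ (\dim {:vT}) - #|F| ^ i))%N.
Proof.
rewrite dimvf; set d := dim vT.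
rewrite -!card_row_free -[RHS]sum1_card.
rewrite (partition_big (fun B : 'M[F]_(k, d) => @mx2vs F vT k B)
   (mem [set U : {vspace vT} | \dim U == k])) /=; last first.
  by move=> B; rewrite !inE /dimv /= genmxE.
rewrite -sum_nat_const; apply: eq_bigr => U; rewrite inE => /eqP dU.
have [A [fA eA]] : exists A : 'M[F]_(k, d), row_free A /\ (A :=: vs2mx U)%MS.
  rewrite /dimv in dU; rewrite -dU.
  by exists (row_base (vs2mx U)); rewrite row_base_free; split=> //; apply: eq_row_base.
rewrite sum1_card -(card_imset _ (row_free_inj fA)).
apply: eq_card => B; apply/imsetP/andP => [[G]|[]].
  rewrite !inE => fG ->; rewrite /row_free mxrankMfree //; split; first by [].
  have GA : (G *m A :=: A)%MS by apply: eqmxMfull; rewrite row_full_unit -row_free_unit.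
  by apply/eqP/val_inj; rewrite /= -[RHS]gen_vs2mx; apply/eq_genmx/(eqmx_trans GA eA).
rewrite inE => fB /eqP eB.
have BA : (B :=: A)%MS.
  by apply: eqmx_trans (eqmx_sym eA); rewrite -eB; apply/eqmx_sym/mx2vsK.
have /submxP[G eG] : (B <= A)%MS by rewrite BA.
exists G => //; rewrite inE.
by move: fB; rewrite eG /row_free mxrankMfree.
Qed.

End RowFreeCount.
(** * Gaussian binomials *)

Section GaussianBinomial.
Variables (R : realFieldType) (q : R).
Hypothesis q1 : 1 < q.

(** This is the usual q-factorial times (q - 1)^n; the extra powers cancel in [gauss]. *)
Definition qfact n : R := \prod_(i < n) (q ^+ i.+1 - 1).

Definition gauss (n k : nat) : R :=
  if (k <= n)%N then qfact n / (qfact k * qfact (n - k)) else 0.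

Lemma qfactS n : qfact n.+1 = qfact n * (q ^+ n.+1 - 1).
Proof. by rewrite /qfact big_ord_recr. Qed.

Lemma qpred_gt0 n : 0 < q ^+ n.+1 - 1.
Proof. by rewrite subr_gt0 exprn_egt1. Qed.

Lemma qfact_gt0 n : 0 < qfact n.
Proof. by apply: prodr_gt0 => i _; apply: qpred_gt0. Qed.

Lemma qpred_neq0 n : q ^+ n.+1 - 1 != 0.
Proof. exact/lt0r_neq0/qpred_gt0. Qed.

Lemma qfact_neq0 n : qfact n != 0.
Proof. exact/lt0r_neq0/qfact_gt0. Qed.

Lemma gauss_small n k : (n < k)%N -> gauss n k = 0.
Proof. by rewrite /gauss ltnNge => /negbTE ->. Qed.

Lemma gauss0 n : gauss n 0 = 1.
Proof. by rewrite /gauss /= subn0 {2}/qfact big_ord0 mul1r divff ?qfact_neq0. Qed.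

Lemma gaussnn n : gauss n n = 1.
Proof. by rewrite /gauss leqnn subnn {3}/qfact big_ord0 mulr1 divff ?qfact_neq0. Qed.

Lemma gaussD a b : gauss (a + b) a = qfact (a + b) / (qfact a * qfact b).
Proof. by rewrite /gauss leq_addr addKn. Qed.

Lemma gauss_sym a b : gauss (a + b) a = gauss (a + b) b.
Proof. by rewrite gaussD addnC gaussD [qfact b * _]mulrC. Qed.

Lemma gauss_pascal n k :
  gauss n.+1 k.+1 = gauss n k + q ^+ k.+1 * gauss n k.+1.
Proof.
case: (ltngtP k n) => [kn|nk|->].
- have [j ->] : exists j, n = (k.+1 + j)%N by exists (n - k.+1)%N; lia.
  rewrite -[(k.+1 + j).+1]addnS gaussD gaussD [(k.+1 + j)%N]addSnnS gaussD.
  rewrite addSn !qfactS -[(k + j.+1).+1]addSn exprD.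
  have := qfact_neq0 k; have := qfact_neq0 j.
  have := qpred_neq0 k; have := qpred_neq0 j; rewrite !exprS => *.
  by field; apply/and4P.
- by rewrite !gauss_small ?mulr0 ?addr0 //; lia.
- by rewrite !gaussnn gauss_small // mulr0 addr0.
Qed.

Lemma gauss_pascal_rev n k : (k <= n)%N ->
  gauss n.+1 k.+1 = q ^+ (n - k) * gauss n k + gauss n k.+1.
Proof.
rewrite leq_eqVlt => /orP[/eqP->|kn].
  by rewrite !gaussnn gauss_small // subnn mul1r addr0.
have [j ->] : exists j, n = (k.+1 + j)%N by exists (n - k.+1)%N; lia.
rewrite -[(k.+1 + j).+1]addnS gaussD gaussD [(k.+1 + j)%N]addSnnS gaussD addKn.
rewrite addSn !qfactS -[(k + j.+1).+1]addSn exprD.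
have := qfact_neq0 k; have := qfact_neq0 j.
have := qpred_neq0 k; have := qpred_neq0 j; rewrite !exprS => *.
by field; apply/and4P.
Qed.

(** For a prime power q, both sides count the flags of an h-space inside an s-space inside a fixed
    t-space. *)
Lemma gauss_mul_comm t s h : (h <= s)%N -> (s <= t)%N ->
  gauss t h * gauss (t - h) (s - h) = gauss t s * gauss s h.
Proof.
move=> hs st; rewrite /gauss (leq_trans hs st) leq_sub2r // st hs.
have -> : (t - h - (s - h) = t - s)%N by lia.
have := qfact_neq0 h; have := qfact_neq0 (t - h); have := qfact_neq0 (s - h).
have := qfact_neq0 s; have := qfact_neq0 (t - s) => *.
by field; apply/and5P.
Qed.

(* Both vanishing of the alternating row sums (c = 0, T > 0) and the count
   q^(tk) of the complements of a subspace (c = T) are instances. *)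
Lemma alternating_gauss_sum N T c : (T <= N)%N ->
  \sum_(j < T.+1) (-1) ^+ j * q ^+ 'C(j, 2) * gauss T j * gauss (N - j) c =
  if (T <= c <= N)%N then q ^+ (T * (N - c)) * gauss (N - T) (c - T) else 0.
Proof.
elim: T N c => [|T IHT] N c leTN.
  rewrite big_ord_recl big_ord0 gauss0 !subn0 mul0n !mul1r addr0.
  by case: (leqP c N) => // /gauss_small ->.
case: N leTN => // N leTN.
(* The Pascal rule splits every [gauss T.+1 j] in two. After a shift of index in one half, the sum
   regroups into differences of consecutive values of [gauss _ c]. *)
have -> : \sum_(j < T.+2) (-1) ^+ j * q ^+ 'C(j, 2) * gauss T.+1 j * gauss (N.+1 - j) c
  = \sum_(j < T.+1) (-1) ^+ j * q ^+ 'C(j, 2) * gauss T j *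
      (q ^+ j * (gauss (N.+1 - j) c - gauss (N - j) c)).
  rewrite big_ord_recl /= gauss0.
  under eq_bigr => j _ do rewrite /bump /= add1n gauss_pascal.
  have e : \sum_(j < T.+1) (-1) ^+ j * q ^+ 'C(j, 2) * (q ^+ j * gauss T j) * gauss (N.+1 - j) c
    = gauss N.+1 c + \sum_(i < T.+1) (-1) ^+ i.+1 * q ^+ 'C(i.+1, 2) *
       (q ^+ i.+1 * gauss T i.+1) * gauss (N.+1 - i.+1) c.
    rewrite [in RHS]big_ord_recr /= (gauss_small (leqnn _)) !(mulr0, mul0r) addr0.
    by rewrite big_ord_recl /= gauss0 subn0 !mul1r.
  rewrite subn0 !mul1r.
  transitivity (\sum_(j < T.+1) (-1) ^+ j * q ^+ 'C(j, 2) * (q ^+ j * gauss T j) * gauss (N.+1 - j) c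
     + \sum_(i < T.+1) (-1) ^+ i.+1 * q ^+ 'C(i.+1, 2) * gauss T i * gauss (N.+1 - i.+1) c).
    rewrite e -addrA -big_split /=; congr (_ + _); apply: eq_bigr => i _; ring.
  rewrite -big_split /=; apply: eq_bigr => i _.
  rewrite subSS binS bin1 exprD exprS; ring.
case: c => [|c].
  by rewrite big1 // => j _; rewrite !gauss0 subrr !mulr0.
have [leNc|ltcN] := ltnP N c.
  rewrite andbC big1 // => [|j _]; last first.
    have jN := ltn_ord j.
    by rewrite [gauss (N.+1 - j) _]gauss_small ?[gauss (N - j) _]gauss_small ?subrr ?mulr0 //; lia.
  by rewrite ltnNge leNc.
(* By the other Pascal rule the difference at [c.+1] is q^(N-j-c) [gauss (N - j) c]. Together with
   q^j this gives q^(N-c), which no longer depends on j, so the induction hypothesis applies at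
   [c]. *)
transitivity (q ^+ (N - c) * \sum_(j < T.+1) (-1) ^+ j * q ^+ 'C(j, 2) * gauss T j * gauss (N - j) c).
  rewrite mulr_sumr; apply: eq_bigr => j _.
  have jN : (j <= N)%N by have := ltn_ord j; lia.
  rewrite subSn //; case: (leqP c (N - j)) => cNj; last first.
    by rewrite [gauss (N - j) c]gauss_small ?[gauss _ c.+1]gauss_small ?subrr ?mulr0 //; lia.
  rewrite gauss_pascal_rev // addrK.
  have -> : (N - c = j + (N - j - c))%N by lia.
  rewrite exprD; ring.
rewrite IHT; last by lia.
rewrite !ltnS ltcN andbT; case: leqP => // _; last by rewrite mulr0.
by rewrite mulrA -exprD !subSS mulSn.
Qed.

End GaussianBinomial.

(** * Subspace counts and [Lambda] in terms of Gaussian binomials *)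

Section GaussCount.
Variable F : finFieldType.
Local Notation q := (#|F|%:R : rat).

Lemma card_field_gt1 : 1 < q.
Proof. by rewrite ltr1n card_finNzRing_gt1. Qed.

(** Extracting q^i from the i-th factor collects q^C(k,2) and leaves the k largest factors of
    [qfact q n]; the hypothesis keeps the subtractions in [nat] exact. *)
Lemma row_free_prod_gauss n k : (k <= n)%N ->
  (\prod_(i < k) (#|F| ^ n - #|F| ^ i))%N%:R * qfact q (n - k) =
  q ^+ 'C(k, 2) * qfact q n.
Proof.
elim: k => [|k IHk] kn; first by rewrite big_ord0 subn0.
rewrite big_ord_recr /= natrM natrB; last first.
  by rewrite leq_exp2l ?card_finNzRing_gt1 // ltnW.
have := IHk (ltnW kn); rewrite binS bin1 exprD.
have -> : (n - k = (n - k.+1).+1)%N by lia.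
rewrite qfactS !natrX.
have -> : q ^+ n = q ^+ k * q ^+ (n - k.+1).+1 by rewrite -exprD; congr (_ ^+ _); lia.
move=> e; rewrite [RHS]mulrAC -e; ring.
Qed.

Lemma card_vspace_gauss (vT : vectType F) k :
  #|[set U : {vspace vT} | \dim U == k]|%:R = gauss q (\dim {:vT}) k.
Proof.
have q1 := card_field_gt1; have [kn|nk] := leqP k (\dim {:vT}); last first.
  rewrite gauss_small // [X in X%:R](_ : _ = 0)%N //; apply: eq_card0 => U.
  by rewrite !inE; apply/negbTE; rewrite neq_ltn (leq_ltn_trans (dimvS (subvf U))).
have := congr1 (fun x => x%:R * qfact q (\dim {:vT} - k) : rat) (card_vspace_dim vT k).
rewrite row_free_prod_gauss // natrM => e.
have := row_free_prod_gauss (leqnn k).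
rewrite subnn {1}/qfact big_ord0 mulr1 => e2; rewrite e2 in e.
rewrite /gauss kn; apply: (mulIf (x := q ^+ 'C(k, 2))).
  by rewrite expf_neq0 // lt0r_neq0 // (lt_trans ltr01).
have := qfact_neq0 q1 k; have := qfact_neq0 q1 (\dim {:vT} - k) => n1 n2.
rewrite [RHS]mulrC [RHS]mulrA -e; field; exact/andP.
Qed.

Lemma qbinom_gauss a b : (qbinom F a%:Z b%:Z)%:R = gauss q a b.
Proof. by rewrite /= card_vspace_gauss dimvf /dim /= mul1n. Qed.

(** Möbius inversion in the subspace lattice: this is [alternating_gauss_sum] at T = N = s and c =
    0, summed in reverse order. *)
Lemma sum_sign_gauss s :
  \sum_(h < s.+1) gauss q s h * (-1) ^+ (s - h) * q ^+ 'C(s - h, 2) = (s == 0%N)%:R.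
Proof.
have q1 := card_field_gt1.
rewrite (reindex_inj rev_ord_inj) /=.
have := alternating_gauss_sum q1 0 (leqnn s).
rewrite andbT leqn0 => e.
transitivity (if s == 0%N then q ^+ (s * (s - 0)) * gauss q (s - s) (0 - s) else 0 : rat); last first.
  by case: eqP => // ->; rewrite mul1r gauss0.
rewrite -e; apply: eq_bigr => h _; rewrite gauss0 // mulr1.
have hs := ltn_ord h; rewrite subSS.
have -> : (s - (s - h) = h)%N by lia.
have -> : gauss q s (s - h) = gauss q s h.
  by have := gauss_sym q h (s - h); rewrite subnKC.
ring.
Qed.

(* The summand h = 0, absent from Lambda, is the number q^(kt) of complements
   of a t-space; with it included, all terms with s > 0 cancel. *)
Lemma Lambda_gauss k t :
  (Lambda F (k + t) t k)%:~R = gauss q (k + t) k - q ^+ (k * t).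
Proof.
have q1 := card_field_gt1.
pose L h s : rat := gauss q t h * (gauss q (t - h) (s - h) * gauss q (k + t - s) t *
  (-1) ^+ (s - h) * q ^+ 'C(s - h, 2)).
have -> : (Lambda F (k + t) t k)%:~R = \sum_(1 <= h < t.+1) \sum_(h <= s < t.+1) L h s.
  rewrite /Lambda rmorph_sum; apply: eq_big_nat => h /andP[h0 ht].
  rewrite rmorphM rmorph_sum -mulr_sumr /= -pmulrn (qbinom_gauss t h).
  congr (_ * _); apply: eq_big_nat => s /andP[hs st].
  rewrite !rmorphM rmorphXn rmorphN1 /= -!pmulrn natrX.
  rewrite !subzn ?qbinom_gauss; try lia.
  by rewrite addKn.
(* After exchanging the sums, the flag identity [gauss_mul_comm] isolates, for each s, the sign sum
   over h <= s, which vanishes unless s = 0. *)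
have all_terms : \sum_(0 <= h < t.+1) \sum_(h <= s < t.+1) L h s = gauss q (k + t) k.
  rewrite big_mkord; under eq_bigr => h _ do rewrite big_geq_mkord.
  rewrite (exchange_big_dep xpredT) //=.
  transitivity (\sum_(s < t.+1) gauss q (k + t - s) t * gauss q t s * ((s : nat) == 0%N)%:R).
    apply: eq_bigr => s _; rewrite -sum_sign_gauss mulr_sumr.
    rewrite (big_ord_widen t.+1 (fun h => gauss q (k + t - s) t * gauss q t s * (gauss q s h * (-1) ^+ (s - h) * q ^+ 'C(s - h, 2)))) ?ltn_ord //.
    apply: eq_big => h; first by rewrite ltnS.
    move=> hs; have st : (s <= t)%N by have := ltn_ord s.
    have e := gauss_mul_comm q1 hs st.
    transitivity (gauss q (k + t - s) t * (gauss q t h * gauss q (t - h) (s - h)) * ((-1) ^+ (s - h) * q ^+ 'C(s - h, 2))).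
      by rewrite /L; ring.
    by rewrite e; ring.
  rewrite big_ord_recl /= big1 ?addr0 ?mulr1 => [|i _]; last by rewrite mulr0.
  by rewrite gauss0 // mulr1 subn0 gauss_sym.
rewrite -all_terms [in RHS]big_ltn // addrAC.
suff -> : \sum_(0 <= s < t.+1) L 0%N s = q ^+ (k * t) by rewrite subrr add0r.
rewrite big_mkord; have := alternating_gauss_sum q1 t (leq_addl k t).
rewrite leqnn leq_addl /= subnn gauss0 // addnK mulr1 mulnC => <-.
apply: eq_bigr => s _; rewrite /L gauss0 // !subn0; ring.
Qed.

End GaussCount.

(** * Estimates for Gaussian binomials and the closing inequality *)

Section GaussBound.
Variables (R : realFieldType) (q : R).
Hypothesis q1 : 1 < q.

(** The Gaussian binomial is the product over 1 <= i <= t of (q^(k+i) - 1) / (q^i - 1), and each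
    factor times 1 - q^-i is at most q^k. *)
Lemma gauss_le k t :
  gauss q (k + t) t * \prod_(i < t) (1 - q^-1 ^+ i.+1) <= q ^+ (k * t).
Proof.
have q0 : 0 < q := lt_trans ltr01 q1.
elim: t => [|t IHt]; first by rewrite gauss0 // big_ord0 muln0 mulr1.
have e : gauss q (k + t.+1) t.+1 * (q ^+ t.+1 - 1) =
         gauss q (k + t) t * (q ^+ (k + t).+1 - 1).
  rewrite addnS /gauss !leq_addl ltnS leq_addl -addnS !addnK !qfactS addnS qfactS.
  have := qfact_neq0 q1 k; have := qfact_neq0 q1 t; have := qpred_neq0 q1 t => *.
  by field; apply/and3P.
rewrite big_ord_recr /= [X in _ * X]mulrC mulrA.
have -> : 1 - q^-1 ^+ t.+1 = (q ^+ t.+1 - 1) * q ^- t.+1.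
  by rewrite mulrBl mul1r divff ?exprVn // expf_neq0 // gt_eqF.
rewrite mulrA e.
rewrite (_ : _ * _ = (gauss q (k + t) t * \prod_(i < t) (1 - q^-1 ^+ i.+1)) *
  ((q ^+ (k + t).+1 - 1) / q ^+ t.+1)); last by ring.
rewrite mulnS exprD mulrC ler_pM //.
- by rewrite mulr_ge0 // ?invr_ge0 ?exprn_ge0 ?ltW ?qpred_gt0.
- rewrite mulr_ge0 ?prodr_ge0 // => [|i _].
    by rewrite /gauss leq_addl mulr_ge0 ?invr_ge0 ?mulr_ge0 // ltW // qfact_gt0.
  by rewrite subr_ge0 exprn_ile1 ?invr_ge0 ?invf_le1 ?ltW.
- rewrite ler_pdivrMr ?exprn_gt0 // -exprD addnS.
  by rewrite gerBl.
Qed.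

(* Truncation of Euler's pentagonal number expansion. *)
Lemma euler_prod_ge (x : R) t : 0 <= x <= 1 -> (0 < t)%N ->
  1 - x - x ^+ 2 + x ^+ t.+1 <= \prod_(i < t) (1 - x ^+ i.+1).
Proof.
move=> /andP[x0 x1]; case: t => // t _; elim: t => [|t IHt].
  by rewrite big_ord_recr big_ord0 /= mul1r expr1 addrNK.
rewrite big_ord_recr /=; set P := \prod_(i < _) _ in IHt *.
have y0 : 0 <= x ^+ t.+1 by apply: exprn_ge0.
have y1 : x ^+ t.+1 <= x by rewrite exprS ler_piMr // exprn_ile1.
move: IHt; rewrite ![x ^+ t.+2]exprSr ![x ^+ t.+3]exprSr ![x ^+ t.+2]exprSr.
move: (x ^+ t.+1) y0 y1 => y y0 y1 IHt.
have xy1 : 0 <= 1 - y * x by rewrite subr_ge0 mulr_ile1 // (le_trans y1).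
apply: le_trans (ler_wpM2r xy1 IHt).
rewrite -subr_ge0.
have -> : (1 - x - x ^+ 2 + y * x) * (1 - y * x) - (1 - x - x ^+ 2 + y * x * x)
  = y * (x ^+ 2 * (x - y)) by ring.
by rewrite !mulr_ge0 ?sqr_ge0 // subr_ge0.
Qed.

(** To be read with B = [k+t, k]_q, K = q^(kt), M the number of MRD codes and z = q^-t. The claim is
    linear in B and M, and B enters with the coefficient c >= 0 once all is moved to one side. Hence
    both may be replaced by their upper bounds K / D and K (q - 1) / (2q - 1), which leaves an
    inequality in x = q^-1 and z. *)
Lemma gauss_weight_le (B K M z : R) : 2 <= q -> 0 <= z <= q ^- 2 -> 0 <= B ->
  B * (1 - q^-1 - q^-1 ^+ 2 + q^-1 * z) <= K ->
  M * (2 * q - 1) <= K * (q - 1) ->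
  q * (B - K) * ((1 + z) / 2) <= B - M.
Proof.
move=> q2 /andP[z0 z1] B0 BK MK.
have q0 : 0 < q by lra.
have x0 : 0 < q^-1 by rewrite invr_gt0.
have x1 : q^-1 <= 2^-1 by rewrite lef_pV2 // posrE.
have xq : q * q^-1 = 1 by rewrite divff // gt_eqF.
rewrite -exprVn in z1.
move: (q^-1) x0 x1 xq BK z1 => x x0 x1 xq BK z1.
have K0 : 0 <= K by apply: le_trans BK; apply: mulr_ge0 => //; nra.
set D := 1 - x - x ^+ 2 + x * z in BK.
have D0 : 0 < D by rewrite /D; nra.
have q21 : 0 < 2 * q - 1 by lra.
suff : (q * (B - K) * ((1 + z) / 2) - B) * D * (2 * q - 1) <= - (K * (q - 1)) * D.
  move=> h; have h2 : - (K * (q - 1)) * D <= - (M * (2 * q - 1)) * D.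
    by rewrite ler_pM2r // lerN2.
  have := le_trans h h2.
  rewrite mulrAC ler_pM2r // -mulNr ler_pM2r //; lra.
set c := q * ((1 + z) / 2) - 1.
have c0 : 0 <= c by rewrite /c; nra.
have -> : (q * (B - K) * ((1 + z) / 2) - B) * D * (2 * q - 1) =
  (2 * q - 1) * (c * (B * D) - K * ((c + 1) * D)) by rewrite /c; ring.
apply: (@le_trans _ _ ((2 * q - 1) * (c * K - K * ((c + 1) * D)))).
  by rewrite ler_pM2l // lerD2r ler_wpM2l.
rewrite -subr_ge0.
have -> : - (K * (q - 1)) * D - (2 * q - 1) * (c * K - K * ((c + 1) * D)) =
   K * (q * D - (2 * q - 1) * (c * (1 - D))) by ring.
apply: mulr_ge0 => //.
have qx : q = x^-1 by rewrite -[LHS]mulr1 -(divff (lt0r_neq0 x0)) mulrA xq mul1r.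
(* Written so that every summand is visibly non-negative for 0 < x <= 1/2 and 0 <= z <= x^2. *)
have -> : q * D - (2 * q - 1) * (c * (1 - D)) =
   q / 2 * (x * ((1 - 2 * x) * (1 + 3 * x) + 4 * (x ^+ 2 - z) + 3 * x * z) + (2 - x) * z ^+ 2).
  rewrite /c /D qx; field; exact: lt0r_neq0.
have x2 : 0 <= 1 - 2 * x by lra.
have xz : 0 <= x * z by rewrite mulr_ge0 // ltW.
have z2 : 0 <= x ^+ 2 - z by lra.
apply: mulr_ge0; first by lra.
apply: addr_ge0; last by rewrite mulr_ge0 ?exprn_ge0 //; lra.
apply: mulr_ge0; first by lra.
have : 0 <= (1 - 2 * x) * (1 + 3 * x) by rewrite mulr_ge0 //; lra.
lra.
Qed.
End GaussBound.
(** * Matrices without eigenvectors *)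

Section Fibers.
Variable F : finFieldType.

(** [A] has a right inverse and [L] a left inverse, so M |-> A M L is linear and onto, and all its
    fibres are translates of one another. *)
Lemma card_mulmx_fiber r a b c (A : 'M[F]_(r, a)) (L : 'M[F]_(b, c)) (B : 'M[F]_(r, c)) :
  row_free A -> row_full L ->
  (#|[set M : 'M[F]_(a, b) | A *m M *m L == B]| * #|F| ^ (r * c) = #|F| ^ (a * b))%N.
Proof.
move=> fA fL; pose fib B := [set M : 'M[F]_(a, b) | A *m M *m L == B].
have fibE B' : #|fib B'| = #|fib B|.
  pose M0 := pinvmx A *m (B' - B) *m pinvmx L.
  have M0E : A *m M0 *m L = B' - B.
    have -> : A *m M0 *m L = (A *m pinvmx A) *m (B' - B) *m (pinvmx L *m L).
      by rewrite /M0 !mulmxA.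
    by rewrite mulmxVp // mul1mx mulVpmx // mulmx1.
  rewrite -(card_imset (fib B) (addrI M0)); apply: eq_card => M.
  apply/idP/imsetP => [|[M1]]; rewrite !inE.
    move=> /eqP MB'; exists (M - M0); last by rewrite addrC subrK.
    by rewrite inE mulmxBr mulmxBl M0E MB' opprB addrC subrK.
  by move=> /eqP M1B ->; rewrite mulmxDr mulmxDl M0E M1B subrK.
rewrite -(card_mx F a b) -(card_mx F r c) -[RHS]sum1_card.
rewrite (partition_big (fun M => A *m M *m L) xpredT) //= mulnC -sum_nat_const.
by apply: eq_bigr => B' _; rewrite sum1_card -/(fib B) -(fibE B'); apply: eq_card => M; rewrite !inE.
Qed.

(** Cauchy-Schwarz for [Z] against the indicator of its support, giving a lower bound on the size of
    the support. With n that size, it comes from summing (n Z(x) - S)^2 >= 0 over the support. *)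
Lemma cauchy_schwarz_support (T : finType) (Z : T -> nat) :
  ((\sum_x Z x) ^ 2 <= #|[set x | Z x != 0]| * \sum_x Z x ^ 2)%N.
Proof.
set n := #|_|; set S := (\sum_x Z x)%N; set Q := (\sum_x _ ^ 2)%N.
have [n0|n_gt0] := posnP n.
  have Z0 x : Z x = 0%N.
    by apply/eqP/negPn/negP => Zx; have := card0_eq n0 x; rewrite inE Zx.
  by rewrite /S big1.
rewrite -(ler_nat rat) natrX natrM.
have QE : Q%:R = \sum_(x | Z x != 0%N) (Z x)%:R ^+ 2 :> rat.
  rewrite /Q natr_sum [RHS]big_mkcond; apply: eq_bigr => x _.
  by case: eqP => [->|_]; rewrite ?natrX.
have SE : S%:R = \sum_(x | Z x != 0%N) (Z x)%:R :> rat.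
  rewrite /S natr_sum [RHS]big_mkcond; apply: eq_bigr => x _.
  by case: eqP => [->|_].
have : 0 <= \sum_(x | Z x != 0%N) (n%:R * (Z x)%:R - S%:R) ^+ 2 :> rat.
  by apply: sumr_ge0 => x _; apply: sqr_ge0.
have -> : \sum_(x | Z x != 0%N) (n%:R * (Z x)%:R - S%:R) ^+ 2 =
  n%:R * (n%:R * Q%:R - S%:R ^+ 2) :> rat.
  transitivity (\sum_(x | Z x != 0%N) (n%:R ^+ 2 * (Z x)%:R ^+ 2 -
    2 * n%:R * S%:R * (Z x)%:R + S%:R ^+ 2) : rat).
    by apply: eq_bigr => x _; ring.
  rewrite big_split sumrB -!mulr_sumr -QE -SE /= sumr_const.
  have -> : #|[pred x | Z x != 0%N]| = n by apply: eq_card => x; rewrite !inE.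
  rewrite -mulr_natl; ring.
by rewrite pmulr_rge0 ?ltr0n // subr_ge0.
Qed.

(** Here p = q, y = q^m and T = q^(m^2); [n0] and [n] count the matrices without and with
    eigenvectors, and [S], [Q] are the first two moments of the number of eigenvectors. Cancelling S
    y in Cauchy-Schwarz gives (y - 1) p T <= n ((p - 1) y + (y - p) p), whose right side falls short
    of n (y - 1) (2p - 1) by n (p - 1)^2; hence n >= p T / (2p - 1). *)
Lemma second_moment_bound (R : realFieldType) (n0 n S Q T y p : R) :
  0 < T -> p <= y -> 1 < p -> 0 <= n -> n0 + n = T -> S * y = (y - 1) * (p * T) ->
  S ^+ 2 <= n * Q ->
  Q * (y * y) <= (y - 1) * ((p - 1) * (p * T) * y + (y - p) * (p ^+ 2 * T)) ->
  n0 * (2 * p - 1) <= T * (p - 1).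
Proof.
move=> T0 py p1 n_ge0 nT Sy cs Qy.
have X0 : 0 < (y - 1) * (p * T) by rewrite !mulr_gt0 //; lra.
have y0 : 0 < y by lra.
have : (S * y) ^+ 2 <= (S * y) * (n * ((p - 1) * y + (y - p) * p)).
  have h1 : S ^+ 2 * (y * y) <= n * Q * (y * y) by rewrite ler_pM2r // mulr_gt0.
  have h2 := ler_wpM2l n_ge0 Qy.
  have -> : (S * y) ^+ 2 = S ^+ 2 * (y * y) by ring.
  apply: (le_trans h1); rewrite -mulrA; apply: (le_trans h2).
  by rewrite Sy le_eqVlt; apply/orP; left; apply/eqP; ring.
rewrite expr2 ler_pM2l ?Sy // => h.
have : (y - 1) * (p * T) <= (y - 1) * (n * (2 * p - 1)).
  apply: (le_trans h); rewrite -subr_ge0.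
  have -> : (y - 1) * (n * (2 * p - 1)) - n * ((p - 1) * y + (y - p) * p) = n * (p - 1) ^+ 2 by ring.
  by rewrite mulr_ge0 ?sqr_ge0.
rewrite ler_pM2l; last by lra.
have -> : n0 = T - n by lra.
lra.
Qed.

Variable m : nat.
Local Notation q := #|F|.

(** Inclusion of row spaces makes these the left eigenvectors, for any eigenvalue in [F] including
    0. *)
Definition eigenvectors (Phi : 'M[F]_m) : {set 'rV[F]_m} :=
  [set v | (v != 0) && (v *m Phi <= v)%MS].

Lemma card_mulmx_preim r (A : 'M[F]_(r, m)) (P : pred 'M[F]_(r, m)) : row_free A ->
  (#|[set Phi : 'M[F]_m | P (A *m Phi)]| * q ^ (r * m) =
   #|[set B | P B]| * q ^ (m * m))%N.
Proof.
move=> fA; rewrite -sum1_card (partition_big (mulmx A) (mem [set B | P B])) /=; last first.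
  by move=> M; rewrite !inE.
rewrite big_distrl -sum_nat_const /=; apply: eq_bigr => B.
rewrite -[X in X -> _]/(is_true (B \in [set B | P B])) inE => PB.
have f1 : row_full (1%:M : 'M[F]_m) by rewrite row_full_unit unitmx1.
rewrite sum1_card -(card_mulmx_fiber B fA f1); congr (_ * _)%N; apply: eq_card => M.
rewrite !inE mulmx1; apply/andP/eqP => [[_ /eqP //]|AM]; split; last exact/eqP.
by rewrite inE AM.
Qed.

Lemma card_line (v : 'rV[F]_m) : v != 0 -> #|[set u : 'rV[F]_m | (u <= v)%MS]| = q.
Proof. by move=> v0; rewrite card_sub_row_free ?expn1 // /row_free rank_rV v0. Qed.

Lemma card_eigen (v : 'rV[F]_m) : v != 0 ->
  (#|[set Phi : 'M[F]_m | (v *m Phi <= v)%MS]| * q ^ m = q * q ^ (m * m))%N.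
Proof.
move=> v0; have fv : row_free v by rewrite /row_free rank_rV v0.
have := card_mulmx_preim (fun u => (u <= v)%MS) fv.
by rewrite mul1n card_line.
Qed.

(** Stacking w and v gives a row free matrix, so the images of v and w under a uniform matrix are
    independent and uniform; each lies on its line with probability q / q^m. *)
Lemma card_eigen2 (v w : 'rV[F]_m) : v != 0 -> ~~ (w <= v)%MS ->
  (#|[set Phi : 'M[F]_m | (v *m Phi <= v)%MS && (w *m Phi <= w)%MS]| * q ^ (m + m) =
   q ^ 2 * q ^ (m * m))%N.
Proof.
move=> v0 wv; have fv : row_free v by rewrite /row_free rank_rV v0.
have w0 : w != 0 by apply: contraNneq wv => ->; rewrite sub0mx.
have fA : row_free (col_mx w v) by rewrite row_free_col_mx_row fv.
have := card_mulmx_preim (fun B : 'M[F]_(1 + 1, m) => (dsubmx B <= v)%MS && (usubmx B <= w)%MS) fA.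
have -> : #|[set B : 'M[F]_(1 + 1, m) | (dsubmx B <= v)%MS && (usubmx B <= w)%MS]| = (q ^ 2)%N.
  rewrite expnS expn1 -[X in (X * _)%N](card_line v0) -[X in (_ * X)%N](card_line w0) -cardsX.
  have inj : injective (fun p : 'rV[F]_m * 'rV[F]_m => col_mx p.2 p.1).
    by move=> [u u'] [t t'] /eq_col_mx[/= -> ->].
  rewrite -(card_imset _ inj); apply: eq_card => B; rewrite inE.
  apply/idP/imsetP => [/andP[Bd Bu]|[[u u']]].
    by exists (dsubmx B, usubmx B); rewrite ?inE ?Bd //= vsubmxK.
  by rewrite !inE /= => /andP[uv uw] ->; rewrite col_mxKd col_mxKu uv.
rewrite mulnDl mul1n => <-; congr (_ * _)%N; apply: eq_card => M.
by rewrite !inE mul_col_mx col_mxKd col_mxKu.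
Qed.

Lemma sum_card_eigenvectors :
  ((\sum_(Phi : 'M[F]_m) #|eigenvectors Phi|) * q ^ m = (q ^ m - 1) * (q * q ^ (m * m)))%N.
Proof.
have -> : (\sum_(Phi : 'M[F]_m) #|eigenvectors Phi| =
  \sum_(v : 'rV[F]_m | v != 0%R) #|[set Phi : 'M[F]_m | (v *m Phi <= v)%MS]|)%N.
  under eq_bigr => Phi _.
    rewrite -sum1_card (eq_bigl (fun v => (v != 0) && (v *m Phi <= v)%MS)); last first.
      by move=> v; rewrite inE.
    rewrite big_mkcondr; over.
  rewrite exchange_big; apply: eq_bigr => v _.
  by rewrite -big_mkcond sum1_card; apply: eq_card => Phi; rewrite inE.
rewrite big_distrl /= (eq_bigr (fun=> q * q ^ (m * m))%N) => [|v v0]; last exact: card_eigen.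
by rewrite sum_nat_const cardC1 card_mx mul1n subn1.
Qed.

(** The second moment counts pairs (v, w) of eigenvectors. For each v, the q - 1 multiples w are
    bounded by the condition on v alone, and the q^m - q remaining w fall under [card_eigen2]. *)
Lemma sum_card_eigenvectors_sq :
  ((\sum_(Phi : 'M[F]_m) #|eigenvectors Phi| ^ 2) * q ^ (m + m) <=
   (q ^ m - 1) * ((q - 1) * (q * q ^ (m * m)) * q ^ m + (q ^ m - q) * (q ^ 2 * q ^ (m * m))))%N.
Proof.
pose N (v w : 'rV[F]_m) := #|[set Phi : 'M[F]_m | (v *m Phi <= v)%MS && (w *m Phi <= w)%MS]|.
have -> : (\sum_(Phi : 'M[F]_m) #|eigenvectors Phi| ^ 2 =
  \sum_(v : 'rV[F]_m | v != 0%R) \sum_(w : 'rV[F]_m | w != 0%R) N v w)%N.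
  transitivity (\sum_(Phi : 'M[F]_m) \sum_(v : 'rV[F]_m | v != 0%R) \sum_(w : 'rV[F]_m | w != 0%R)
     ((v *m Phi <= v)%MS && (w *m Phi <= w)%MS : nat))%N.
    apply: eq_bigr => Phi _.
    have -> : #|eigenvectors Phi| = (\sum_(v : 'rV[F]_m | v != 0%R) (v *m Phi <= v)%MS)%N.
      rewrite -sum1_card [RHS](eq_bigr (fun v => if (v *m Phi <= v)%MS then 1%N else 0%N)).
        by rewrite -big_mkcondr; apply: eq_bigl => v; rewrite inE.
      by move=> v _; case: (_ <= _)%MS.
    rewrite expnS expn1 big_distrlr /=; apply: eq_bigr => v _; apply: eq_bigr => w _.
    by rewrite mulnb.
  rewrite exchange_big; apply: eq_bigr => v _.
  rewrite exchange_big; apply: eq_bigr => w _.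
  rewrite /N -sum1_card [RHS]big_mkcond; apply: eq_bigr => Phi _.
  by rewrite inE; case: (_ && _).
have -> : (q ^ m - 1)%N = #|predC1 (0 : 'rV[F]_m)| by rewrite cardC1 card_mx mul1n subn1.
rewrite big_distrl -sum_nat_const /=; apply: leq_sum => v v0.
rewrite (bigID (fun w => (w <= v)%MS)) /= mulnDl expnD; apply: leq_add.
  rewrite mulnA leq_mul2r; apply/orP; right.
  rewrite big_distrl /=.
  apply: (@leq_trans (\sum_(w : 'rV[F]_m | (w != 0%R) && (w <= v)%MS) q * q ^ (m * m))).
    apply: leq_sum => w _; rewrite -(card_eigen v0) leq_mul2r; apply/orP; right.
    by apply: subset_leq_card; apply/subsetP => Phi; rewrite !inE => /andP[].
  rewrite sum_nat_const leq_mul2r; apply/orP; right.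
  rewrite -(card_line v0) (cardsD1 0) inE sub0mx addKn.
  by apply: subset_leq_card; apply/subsetP => w; rewrite !inE.
rewrite -expnD big_distrl /=.
apply: (@leq_trans (\sum_(w : 'rV[F]_m | ~~ (w <= v)%MS) q ^ 2 * q ^ (m * m))).
  rewrite [leqRHS](eq_bigl (fun w : 'rV[F]_m => (w != 0) && ~~ (w <= v)%MS)) => [|w].
    by apply: leq_sum => w /andP[_ wv]; rewrite card_eigen2.
  by case: eqP => [->|//]; rewrite sub0mx.
rewrite sum_nat_const leq_mul2r; apply/orP; right.
have -> : (q ^ m)%N = #|{: 'rV[F]_m}| by rewrite card_mx mul1n.
rewrite -(cardsC [set u : 'rV[F]_m | (u <= v)%MS]) card_line // addKn.
by apply: subset_leq_card; apply/subsetP => w; rewrite !inE.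
Qed.

(* Cauchy-Schwarz for the number of eigenvectors, using that being eigenvectors
   is independent for two non-proportional vectors. *)
Lemma card_no_eigenvector : (0 < m)%N ->
  (#|[set Phi : 'M[F]_m | eigenvectors Phi == set0]|%:R * (2 * q%:R - 1) <=
   q%:R ^+ (m * m) * (q%:R - 1) :> rat).
Proof.
move=> m0; set S0 := [set Phi | _].
have card_compl : (#|S0| + #|[set Phi : 'M[F]_m | #|eigenvectors Phi| != 0%N]| = q ^ (m * m))%N.
  rewrite -(card_mx F m m) -(cardsC S0); congr (_ + _)%N; apply: eq_card => Phi.
  by rewrite !inE cards_eq0.
have cs := cauchy_schwarz_support (fun Phi => #|eigenvectors Phi|).
have q1 : (1 < q)%N := card_finNzRing_gt1 F.
have qy : (q <= q ^ m)%N by rewrite -[leqLHS]expn1 leq_exp2l.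
have y1 : (1 <= q ^ m)%N by rewrite expn_gt0 ltnW.
have := sum_card_eigenvectors; have := sum_card_eigenvectors_sq.
set S := (\sum_Phi _)%N in cs *; set Q := (\sum_Phi _)%N in cs *.
set n := #|[set Phi | #|eigenvectors Phi| != 0%N]| in card_compl cs => Qy Sy.
rewrite -natrX; apply: (@second_moment_bound rat #|S0|%:R n%:R S%:R Q%:R _ (q ^ m)%:R).
- by rewrite ltr0n expn_gt0 ltnW.
- by rewrite ler_nat.
- by rewrite ltr1n.
- exact: ler0n.
- by rewrite -card_compl natrD.
- by rewrite -natrM Sy !natrM natrB.
- by rewrite -natrX -natrM ler_nat.
move: Qy; rewrite -(ler_nat rat) expnD !natrM natrB // natrD !natrM !natrB //; last exact: ltnW.
Qed.

End Fibers.
(** * MRD codes as graphs *)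

Section MRDCount.
Variables (F : finFieldType) (r e m : nat).
Local Notation a := r.+1.
Local Notation b := e.+1.

(** Linear maps between blocks are encoded as matrices acting on vectorised blocks. Extracting the m
    x m block is then a two-sided multiplication, to which [card_mulmx_fiber] applies. *)
Definition top_row_mx (p : nat) : 'M[F]_(m, p.+1 * m) :=
  lin1_mx (mxvec \o mulmx (delta_mx ord0 ord0 : 'cV[F]_p.+1)).

Definition read_top_row_mx (p : nat) : 'M[F]_(p.+1 * m, m) :=
  lin1_mx (row (ord0 : 'I_p.+1) \o vec_mx).

Lemma top_row_mxK p : top_row_mx p *m read_top_row_mx p = 1%:M.
Proof.
apply/row_matrixP => i; rewrite !rowE mulmxA !mul_rV_lin1 /= mxvecK mulmx1.
by rewrite row_mul rowE mul_delta_mx [delta_mx _ _]mx11_scalar mxE !eqxx mul1mx.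
Qed.

Definition graph_block (M : 'M[F]_(a * m, b * m)) : 'M[F]_m :=
  top_row_mx r *m M *m read_top_row_mx e.

Definition graph_map (M : 'M[F]_(a * m, b * m)) (X : 'rV[F]_(a * m)) : 'M[F]_(a + b, m) :=
  col_mx (vec_mx X) (vec_mx (X *m M)).

Definition has_graph (C : {vspace 'M[F]_(a + b, m)}) (M : 'M[F]_(a * m, b * m)) : bool :=
  [forall X, graph_map M X \in C].

Variable C : {vspace 'M[F]_(a + b, m)}.
Hypothesis rankC : forall A, A \in C -> A != 0 -> (b < \rank A)%N.

(** Only e + 1 rows of such a codeword can be non-zero, too few for the rank of a non-zero codeword.
    Thus the projection of [C] to the top block is injective. *)
Lemma top_block_eq0 A : A \in C -> usubmx A = 0 -> A = 0.
Proof.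
move=> CA A0; apply/eqP/negPn/negP => An0; have := rankC CA An0.
rewrite -(vsubmxK A) A0 ltnNge => /negP; apply.
by rewrite rank_col_0mx rank_leq_row.
Qed.

(** The injective projection to the top block is onto by dimension. The rows of [M] are the
    vectorised bottom blocks of codewords lifting the unit matrices. *)
Lemma has_graph_ex : \dim C = (a * m)%N -> exists M, has_graph C M.
Proof.
move=> dC; pose f := linfun (usubmx : 'M[F]_(a + b, m) -> 'M[F]_(a, m)).
have fC : (f @: C)%VS = fullv.
  apply/eqP; rewrite eqEdim subvf limg_dim_eq ?dC ?dimvf ?dim_matrix //=.
  apply/eqP; rewrite -subv0; apply/subvP => A; rewrite memv_cap memv_ker lfunE memv0.
  by move=> /andP[CA /eqP A0]; apply/eqP/top_block_eq0.
have lift_ex i : exists A, (A \in C) && (usubmx A == vec_mx (delta_mx 0 i)).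
  have : vec_mx (delta_mx 0 i) \in (f @: C)%VS by rewrite fC memvf.
  by case/memv_imgP => A CA AE; exists A; rewrite CA AE lfunE /=.
pose c i := xchoose (lift_ex i).
have cC i : c i \in C by have /andP[] := xchooseP (lift_ex i).
have cU i : usubmx (c i) = vec_mx (delta_mx 0 i).
  by have /andP[_ /eqP] := xchooseP (lift_ex i).
exists (\matrix_i mxvec (dsubmx (c i))); apply/forallP => X.
have -> : graph_map (\matrix_i mxvec (dsubmx (c i))) X = \sum_i X 0 i *: c i.
  rewrite -[RHS]vsubmxK /graph_map; congr col_mx.
    rewrite [X in LHS]row_sum_delta !linear_sum; apply: eq_bigr => i _.
    by rewrite !linearZ /= cU.
  rewrite mulmx_sum_row !linear_sum; apply: eq_bigr => i _.
  by rewrite !linearZ /= rowK mxvecK.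
by apply: memv_suml => i _; apply: memvZ.
Qed.

(** Two codewords with the same top block differ by one with zero top block. So [M] determines
    [C]. *)
Lemma has_graphP M : has_graph C M ->
  forall A, (A \in C) = (A == graph_map M (mxvec (usubmx A))).
Proof.
move/forallP => gM A; apply/idP/eqP => [CA|->]; last exact: gM.
apply/eqP; rewrite -subr_eq0; apply/eqP/top_block_eq0; first by rewrite memvB.
by rewrite linearB /= /graph_map col_mxKu mxvecK subrr.
Qed.

(* If v is an eigenvector, then the codeword with top block (v, 0, ..., 0) has
   two proportional rows and r zero rows, hence rank at most e + 1. *)
Lemma graph_block_no_eigenvector M : has_graph C M -> eigenvectors (graph_block M) = set0.
Proof.
move/forallP => gM; apply/setP => v; rewrite !inE; apply/negbTE/negP => /andP[v0 vv].
pose X := v *m top_row_mx r.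
have XE : vec_mx X = (delta_mx ord0 ord0 : 'cV[F]_a) *m v.
  by rewrite /X mul_rV_lin1 /= mxvecK.
have X0 : vec_mx X != 0.
  apply: contraNneq v0 => /(congr1 (row ord0)).
  rewrite XE row_mul rowE mul_delta_mx [delta_mx _ _]mx11_scalar mxE !eqxx mul1mx.
  by rewrite row0 => ->.
have gX0 : graph_map M X != 0.
  by apply: contraNneq X0 => /(congr1 usubmx); rewrite col_mxKu linear0 => ->.
have := rankC (gM X) gX0; rewrite ltnNge => /negP; apply.
pose D := vec_mx (X *m M).
have D0 : row ord0 D = v *m graph_block M.
  by rewrite /graph_block !mulmxA -/X mul_rV_lin1.
have sub : (graph_map M X <= col_mx v (row' ord0 D))%MS.
  apply/row_subP => i; rewrite -addsmxE.
  case: (split_ordP i) => j ->.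
    rewrite rowKu XE row_mul; apply: submx_trans (addsmxSl _ _); exact: submxMl.
  rewrite rowKd -/D; case: (unliftP ord0 j) => [k ->|->].
    apply: submx_trans (addsmxSr _ _).
    have -> : row (lift ord0 k) D = row k (row' ord0 D) by apply/rowP => l; rewrite !mxE.
    exact: row_sub.
  by rewrite D0; apply: submx_trans vv (addsmxSl _ _).
by apply: leq_trans (mxrankS sub) (rank_leq_row _).
Qed.

End MRDCount.

(** * Upper bound on the number of MRD codes *)

Section MRDBound.
Variables (F : finFieldType) (r e m : nat).
Local Notation a := r.+1.
Local Notation b := e.+1.
Local Notation q := (#|F|%:R : rat).

(** The indices stand for n = r + e + 2 and d = e + 2: there are n - d + 1 top rows and d - 1 bottom
    rows, and the distance is required to be at least d. *)
Definition MRD_codes : {set {vspace 'M[F]_(a + b, m)}} :=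
  [set C | (\dim C == a * m)%N && (b < min_rank_distance C)%N].

Lemma min_rank_distance_gt (C : {vspace 'M[F]_(a + b, m)}) :
  (b < min_rank_distance C)%N -> forall A, A \in C -> A != 0 -> (b < \rank A)%N.
Proof.
move=> bC A CA A0; apply: leq_trans bC _.
have := @bigmin_le_cond _ nat _ (a + b)%N A (fun A => (A \in C) && (A != 0)) (fun A => \rank A).
by rewrite CA A0 => /(_ isT).
Qed.

Lemma card_MRD_codes_graph :
  (#|MRD_codes| <= #|[set M : 'M[F]_(a * m, b * m) | eigenvectors (graph_block M) == set0]|)%N.
Proof.
(* The default 0 is never taken on MRD codes, by [has_graph_ex]. *)
pose g (C : {vspace 'M[F]_(a + b, m)}) := odflt 0 [pick M | has_graph C M].
have gP C : C \in MRD_codes -> has_graph C (g C).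
  rewrite inE => /andP[/eqP dC bC]; rewrite /g; case: pickP => //= no.
  by have [M] := has_graph_ex (min_rank_distance_gt bC) dC; rewrite no.
have gI : {in MRD_codes &, injective g}.
  move=> C C' CM CM' gCC; apply/vspaceP => A.
  have := CM; have := CM'; rewrite !inE => /andP[_ bC'] /andP[_ bC].
  rewrite (has_graphP (min_rank_distance_gt bC) (gP _ CM)).
  by rewrite (has_graphP (min_rank_distance_gt bC') (gP _ CM')) gCC.
rewrite -(card_in_imset gI); apply: subset_leq_card; apply/subsetP => M /imsetP[C CM ->].
rewrite inE; apply/eqP; have := CM; rewrite inE => /andP[_ bC].
have h := graph_block_no_eigenvector (min_rank_distance_gt bC) (gP _ CM); exact: h.
Qed.

(** [graph_block] is onto with fibres of equal size, so a property of the block has the same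
    proportion among the large matrices as among the m x m ones. *)
Lemma card_graph_block (P : pred 'M[F]_m) :
  (#|[set M : 'M[F]_(a * m, b * m) | P (graph_block M)]| * #|F| ^ (m * m) =
   #|[set Phi | P Phi]| * #|F| ^ (a * m * (b * m)))%N.
Proof.
have fE : row_free (top_row_mx F m r) by apply/row_freeP; exists (read_top_row_mx F m r); apply: top_row_mxK.
have fL : row_full (read_top_row_mx F m e) by apply/row_fullP; exists (top_row_mx F m e); apply: top_row_mxK.
rewrite -sum1_card (partition_big (@graph_block F r e m) (mem [set Phi | P Phi])) /=; last first.
  by move=> M; rewrite !inE.
rewrite big_distrl -sum_nat_const /=; apply: eq_bigr => B.
rewrite -[X in X -> _]/(is_true (B \in [set B | P B])) inE => PB.
rewrite sum1_card -(card_mulmx_fiber B fE fL); congr (_ * _)%N; apply: eq_card => M.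
rewrite !inE; apply/andP/eqP => [[_ /eqP //]|AM]; split; last exact/eqP.
by rewrite inE /graph_block AM.
Qed.

Lemma card_MRD_codes_le : (0 < m)%N ->
  #|MRD_codes|%:R * (2 * q - 1) <= q ^+ (a * m * (b * m)) * (q - 1).
Proof.
move=> m0; have q1 := card_field_gt1 F.
have := card_graph_block (fun Phi => eigenvectors Phi == set0).
move=> /(congr1 (fun n => n%:R : rat)); rewrite !natrM !natrX => e1.
have := card_no_eigenvector F m0.
have := card_MRD_codes_graph; rewrite -(ler_nat rat).
set N := #|[set Phi | _]| in e1 *; set N' := #|[set M | _]| in e1 *.
have T0 : 0 < q ^+ (m * m) by rewrite exprn_gt0 // (lt_trans ltr01).
have T1 : 0 <= q ^+ (a * m * (b * m)) by rewrite exprn_ge0 // ltW // (lt_trans ltr01).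
have p0 : 0 < 2 * q - 1 by lra.
move=> h1 h2; apply: (le_trans (_ : _ <= N'%:R * (2 * q - 1))); first by rewrite ler_pM2r.
rewrite -(ler_pM2r T0) mulrAC e1.
have -> : N%:R * q ^+ (a * m * (b * m)) * (2 * q - 1) =
  q ^+ (a * m * (b * m)) * (N%:R * (2 * q - 1)) by ring.
by rewrite mulrAC -mulrA ler_wpM2l.
Qed.

End MRDBound.

(** * Passing to the complement and assembling the bound *)

Lemma card_nonMRD_codes (F : finFieldType) (r e m : nat) :
  (#|nonMRD_codes F (r.+1 + e.+1) m e.+2 (r.+1 * m)| + #|MRD_codes F r e m| =
   #|[set C : {vspace 'M[F]_(r.+1 + e.+1, m)} | \dim C == r.+1 * m]|)%N.
Proof.
rewrite -[RHS](cardsID [set C | (min_rank_distance C <= e.+1)%N]); congr (_ + _)%N.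
  by apply: eq_card => C; rewrite !inE subn1.
by apply: eq_card => C; rewrite !inE -ltnNge andbC.
Qed.

Theorem theorem6p1 (q : nat) (F : finFieldType) (hq : #|F| = q)
    (m n d k : nat) (hn : (2 <= n)%N) (hmn : (n <= m)%N)
    (hd : (2 <= d <= n)%N) (hk : k = (m * (n - d + 1))%N) :
  (#|nonMRD_codes F n m d k|%:R : rat) >=
    q%:R * (Lambda F (m * n) (m * (d - 1)) k)%:~R *
    (1 - ((q%:R ^+ k - 1) * (q%:R ^+ (m * n - k) - 1)) /
         (2 * (q%:R ^+ (m * n) - q%:R ^+ (m * n - k)))).
Proof.
subst q; have q1 := card_field_gt1 F; set q := (#|F|%:R : rat) in q1 *.
have [r [e [nE dE]]] : exists r e, n = (r.+1 + e.+1)%N /\ d = e.+2.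
  by exists (n - d)%N, (d - 2)%N; move: hd; lia.
have m2 : (2 <= m)%N := leq_trans hn hmn.
move: hk; rewrite {}nE {}dE {hn hmn hd n d} => hk.
have {}hk : k = (r.+1 * m)%N by rewrite hk mulnC; congr (_ * _)%N; lia.
pose t := (e.+1 * m)%N.
have -> : (m * (e.+2 - 1) = t)%N by rewrite subn1 mulnC.
have NE : (m * (r.+1 + e.+1) = k + t)%N by rewrite hk /t mulnC mulnDl.
rewrite NE addKn Lambda_gauss -/q.
have k_gt0 : (0 < k)%N by rewrite hk muln_gt0 (ltnW m2).
have t2 : (2 <= t)%N by apply: leq_trans m2 _; rewrite leq_pmull.
have q0 : 0 < q := lt_trans ltr01 q1.
have qk : 0 < q ^+ k - 1 by rewrite subr_gt0 exprn_egt1 // -lt0n.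
(* The denominator contains q^(k+t) - q^t = (q^k - 1) q^t, so the factor q^k - 1 cancels. *)
have -> : 1 - (q ^+ k - 1) * (q ^+ t - 1) / (2 * (q ^+ (k + t) - q ^+ t)) = (1 + q ^- t) / 2.
  have qt : 0 < q ^+ t by rewrite exprn_gt0.
  have -> : q ^+ (k + t) - q ^+ t = (q ^+ k - 1) * q ^+ t by rewrite exprD; ring.
  by field; rewrite !gt_eqF.
have := card_nonMRD_codes F r e m; rewrite -hk => /(congr1 (fun n => n%:R : rat)).
have dE : \dim {:'M[F]_(r.+1 + e.+1, m)} = (k + t)%N.
  by rewrite dimvf dim_matrix -NE; apply: mulnC.
rewrite natrD card_vspace_gauss dE -/q => cardE.
have -> : #|nonMRD_codes F (r.+1 + e.+1) m e.+2 k|%:R =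
  gauss q (k + t) k - #|MRD_codes F r e m|%:R by rewrite -cardE addrK.
have B0 : 0 <= gauss q (k + t) k.
  by rewrite /gauss leq_addr divr_ge0 ?mulr_ge0 // ltW // qfact_gt0.
(* Here z = q^-t, and z <= q^-2 because t >= m >= 2. The term q^-1 z of the lemma is the last term
   of [euler_prod_ge] at x = q^-1. *)
apply: gauss_weight_le => //.
- by rewrite ler_nat; have := card_field_gt1 F; rewrite ltr1n.
- by rewrite invr_ge0 (exprn_ge0 _ (ltW q0)) lef_pV2 ?posrE ?exprn_gt0 // ler_eXn2l.
- apply: le_trans (gauss_le q1 k t).
  rewrite -gauss_sym ler_wpM2l //.
  rewrite -[q ^- t]exprVn -exprS; apply: euler_prod_ge.
    by rewrite invr_ge0 (ltW q0) invf_le1 // ltW.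
  exact: ltnW.
- by have := card_MRD_codes_le F r e (ltnW m2); rewrite -/q -hk.
Qed.
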